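(* Let $O^{(1)},\dots,O^{(k)}$ be arbitrary operators on $h$ and let $t_1,\dots,t_k\in\{0,\dots,N-1\}$, where repetitions are allowed. Then $$\mathrm{Tr}\Big[Pe^{i\epsilon\mathcal P}\,O^{(1)}_{t_1}\cdots O^{(k)}_{t_k}\Big]=\mathrm{tr}\Big[\hat T\big[O^{(1)}(t_1)\cdots O^{(k)}(t_k)\big]\Big],$$ where $O^{(l)}(t_l)$ denotes the operator $O^{(l)}$ itself, carrying the time label $t_l$.
   Context: Fix integers $L\ge1$, $N\ge1$, a real $\epsilon>0$, and set $T=\epsilon N$. The space $h$. Let $h$ be the fermionic Fock space of $L$ modes, with vacuum $|0\rangle$, ladder operators $a_i$ satisfying $\{a_i,a_j^\dagger\}=\delta_{ij}$ and $\{a_i,a_j\}=\{a_i^\dagger,a_j^\dagger\}=0$, and trace $\mathrm{tr}$. The space $\mathcal H$. Let $\mathcal H$ be the Fock space generated from a vacuum $|\Omega\rangle$ by $a_{ti}$, $t=0,\dots,N-1$, $i=1,\dots,L$, with $\{a_{ti},a^\dagger_{t'j}\}=\delta_{tt'}\delta_{ij}$ and all other anticommutators zero. The symbol $\mathrm{Tr}$ is the trace on $\mathcal H$. Time translations and parity. Set $\omega_n=(2n+1)\pi/T$ and $\hat a_{ni}=N^{-1/2}\sum_te^{i\omega_n\epsilon t}a_{ti}$. Define $$\mathcal P=\sum_{n,j}\omega_n\hat a^\dagger_{nj}\hat a_{nj},\qquad P=\exp\Big(i\pi\sum_{t,i}a^\dagger_{ti}a_{ti}\Big).$$ Placing operators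 on a slice. For an operator $O$ on $h$, $O_t$ denotes its image under the unital $*$-homomorphism determined by $a_i\mapsto a_{ti}$. Equivalently, substitute $a_i\to a_{ti}$ and $a_j^\dagger\to a^\dagger_{tj}$ in a polynomial expression of $O$. Parity. An operator on $h$ is even (resp. odd) if it commutes (resp. anticommutes) with $e^{i\pi\sum_ia_i^\dagger a_i}$. Fermionic time ordering $\hat T$. Let $B_1,\dots,B_k$ be operators of definite parity with real labels $s_1,\dots,s_k$. Let $\sigma$ be the unique permutation with $s_{\sigma(1)}\ge\dots\ge s_{\sigma(k)}$ that preserves the relative order of equal labels. Define $$\hat T[B_1\cdots B_k]=(-1)^\gamma B_{\sigma(1)}\cdots B_{\sigma(k)},$$ where $\gamma$ is the number of pairs of odd operators whose order is reversed by $\sigma$. $\hat T$ is extended multilinearly by splitting operators into even and odd parts. *)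

(* Defs.v *)
From HB Require Import structures.
From mathcomp Require Import all_boot all_order all_algebra.
From mathcomp Require Import complex.
From mathcomp Require Import all_classical all_reals all_analysis.
Set Implicit Arguments. Unset Strict Implicit. Unset Printing Implicit Defensive.
Import Order.TTheory GRing.Theory Num.Theory numFieldNormedType.Exports.
Local Open Scope ring_scope.
Local Open Scope complex_scope.

(* Fermionic Fock space over a finite set of modes M.                  *)
(* Occupation-number basis |S>, S : {set M}; |S> = a^+_{m1}...a^+_{mr}|0>
   with m1 < ... < mr in the order given by enum_rank.                 *)

Definition fdim (M : finType) : nat := #|{: {set M}}|.

Definition op (R : realType) (M : finType) := 'M[R[i]]_(fdim M).

Definition bstate (M : finType) (r : 'I_(fdim M)) : {set M} := enum_val r.

Definition ladder (R : realType) (M : finType) (m : M) : op R M :=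
  \matrix_(r, c)
    (if (m \in bstate c) && (bstate r == bstate c :\ m)
     then (-1) ^+ #|[set j in bstate c | enum_rank j < enum_rank m]%N|
     else 0).

Definition adj (R : realType) (n : nat) (A : 'M[R[i]]_n) : 'M[R[i]]_n :=
  \matrix_(r, c) conjc (A c r).

Definition numop (R : realType) (M : finType) : op R M :=
  \sum_(m : M) (adj (ladder R m) *m ladder R m).

Definition mx_psum (R : realType) (n : nat) (A : 'M[R[i]]_n) (K : nat) :
  'M[R[i]]_n := \sum_(j < K) ((j`!)%:R^-1 *: A ^+ j).

Definition mxexp (R : realType) (n : nat) (A : 'M[R[i]]_n) : 'M[R[i]]_n :=
  \matrix_(r, c)
    ((limn (fun K => complex.Re (mx_psum A K r c))) +i*
     (limn (fun K => complex.Im (mx_psum A K r c)))).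

Definition expi (R : realType) (x : R) : R[i] := cos x +i* sin x.

Definition parity (R : realType) (M : finType) : op R M :=
  mxexp (((0 +i* 1) * (pi : R)%:C) *: numop R M).

Definition hmodes (L : nat) := 'I_L.
Definition Hmodes (N L : nat) := ('I_N * 'I_L)%type.

Definition omega (R : realType) (N : nat) (eps : R) (n : nat) : R :=
  (2 * n + 1)%:R * pi / (eps * N%:R).

Definition ahat (R : realType) (N L : nat) (eps : R) (n : 'I_N) (j : 'I_L)
  : op R (Hmodes N L) :=
  ((Num.sqrt (N%:R : R))^-1)%:C *:
    \sum_(t < N) (expi (omega N eps n * eps * (t : nat)%:R) *: ladder R (t, j)).

Definition Pmom (R : realType) (N L : nat) (eps : R) : op R (Hmodes N L) :=
  \sum_(n < N) \sum_(j < L)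
     ((omega N eps n)%:C *: (adj (ahat eps n j) *m ahat eps n j)).

Definition slice_maps (R : realType) (N L : nat)
  (iota : 'I_N -> op R (hmodes L) -> op R (Hmodes N L)) : Prop :=
  forall t : 'I_N,
  (forall A B, iota t (A + B) = iota t A + iota t B) /\
  (forall (c : R[i]) A, iota t (c *: A) = c *: iota t A) /\
  (forall A B, iota t (A *m B) = iota t A *m iota t B) /\
  iota t 1%:M = 1%:M /\
  (forall A, iota t (adj A) = adj (iota t A)) /\
  (forall i : 'I_L, iota t (ladder R i) = ladder R (t, i)).

Definition par_part (R : realType) (M : finType) (odd_part : bool)
  (O : op R M) : op R M :=
  let Pc := parity R M *m O *m invmx (parity R M) in
  (2%:R^-1 : R[i]) *: (if odd_part then O - Pc else O + Pc).

Definition tsort (k : nat) (s : 'I_k -> nat) : seq 'I_k :=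
  sort (fun l m => s m <= s l)%N (enum 'I_k).

Definition tgamma (k : nat) (s : 'I_k -> nat) (b : {ffun 'I_k -> bool}) : nat :=
  #|[set p : 'I_k * 'I_k |
      [&& (p.1 < p.2)%N, b p.1, b p.2 &
          (index p.2 (tsort s) < index p.1 (tsort s))%N]]|.

(* hat T [O_1(s_1) ... O_k(s_k)], extended multilinearly through the
   even/odd decomposition: b l = true selects the odd part of O_l. *)
Definition Tord (R : realType) (M : finType) (k : nat)
  (O : 'I_k -> op R M) (s : 'I_k -> nat) : op R M :=
  \sum_(b : {ffun 'I_k -> bool})
     ((-1) ^+ tgamma s b *: \prod_(l <- tsort s) par_part (b l) (O l)).

(* Main.v *)
Require Import Defs.
From HB Require Import structures.
From mathcomp Require Import all_boot all_order all_algebra.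
From mathcomp Require Import complex.
From mathcomp Require Import all_classical all_reals all_analysis.
From mathcomp Require Import ring.
Set Implicit Arguments. Unset Strict Implicit. Unset Printing Implicit Defensive.
Import Order.TTheory GRing.Theory Num.Theory numFieldNormedType.Exports.
Local Open Scope ring_scope.
Local Open Scope complex_scope.

(** Write U = e^(i eps P) for the time translation and P for the parity on the
    big Fock space. Diagonalising the momentum by a discrete Fourier transform
    gives U c_t = c_(t+1) U for every generator c, with c_N = - c_0, while P
    anticommutes with every generator. Carrying a generator once around
    Tr[P U A c_t B] therefore moves it to slice t+1 with no net sign as soon as
    A avoids slice t and B avoids slice t+1. If the labels decrease from left
    to right, the factors can be glued one by one into a single slice, so the
    trace is f(O_1 ... O_k) with f(Y) = Tr[P U Y_0]. The antiperiodicity makes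
    f cyclic, hence a multiple of tr; the factor is f(|0><0|) = 1, because
    gluing identifies it with Tr[P U |Omega><Omega|]. Arbitrary labels reduce
    to decreasing ones by splitting every operator into its even and odd parts:
    parts on distinct slices commute up to sign, which yields the sign of the
    time ordering. *)

(** * Ladder operators as signed monomial matrices, and the canonical anticommutation relations *)

Section Monomial.
Variables (R : realType) (M : finType).
Implicit Types (m : M) (S : {set M}) (f g : {set M} -> {set M}).
Implicit Types (u v : {set M} -> R[i]).

(** The operator |S> -> u(S) |f(S)>. Ladder operators and their products all have this shape, so
    operator identities reduce to identities between set maps and coefficients. *)
Definition mono f u : op R M :=
  \matrix_(r, c) (u (bstate c) *+ (bstate r == f (bstate c))).

(** The maps are compared only where the coefficient is nonzero: adding a mode undoes its removal
    only on states that contain it. *)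
Lemma mono_eq f g u v :
  (forall S, u S = v S) -> (forall S, u S != 0 -> f S = g S) ->
  mono f u = mono g v.
Proof.
move=> uv fg; apply/matrixP=> r c; rewrite !mxE -uv.
by have [->|/fg->//] := eqVneq (u (bstate c)) 0; rewrite !mul0rn.
Qed.

Lemma mono_mul f g u v :
  mono f u *m mono g v = mono (f \o g) (fun S => u (g S) * v S).
Proof.
apply/matrixP=> r c; rewrite !mxE (bigD1 (enum_rank (g (bstate c)))) //=.
rewrite !mxE /bstate !enum_rankK eqxx mulr1n big1 ?addr0 ?mulrnAl// => j jN.
rewrite !mxE /bstate [_ == g _](_ : _ = false) ?mulr0n ?mulr0//.
by apply: contra_neqF jN => /eqP<-; rewrite enum_valK.
Qed.

Lemma mono_add f u v : mono f u + mono f v = mono f (fun S => u S + v S).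
Proof. by apply/matrixP=> r c; rewrite !mxE -mulrnDl. Qed.

Lemma mono1 : mono id (fun=> 1) = 1%:M.
Proof.
apply/matrixP=> r c; rewrite !mxE.
by rewrite (inj_eq (@enum_val_inj _ _)).
Qed.

Lemma mono0 f u : (forall S, u S = 0) -> mono f u = 0.
Proof. by move=> u0; apply/matrixP=> r c; rewrite !mxE u0 mul0rn. Qed.

Lemma mono_delta f u S (r : 'I_(fdim M)) :
  mono f u *m delta_mx (enum_rank S) r = u S *: delta_mx (enum_rank (f S)) r.
Proof.
apply/matrixP=> i j; rewrite !mxE (bigD1 (enum_rank S)) //= !mxE eqxx /=.
rewrite big1 => [|l lS]; last by rewrite !mxE (negPf lS) mulr0.
rewrite addr0 /bstate enum_rankK (can2_eq (@enum_valK _) (@enum_rankK _)).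
by case: (i == _); rewrite ?mulr1n ?mul0r ?mulr0.
Qed.

Lemma mono_prod (I : Type) (r : seq I) (w : I -> {set M} -> R[i]) :
  \prod_(x <- r) mono id (w x) = mono id (fun S => \prod_(x <- r) w x S).
Proof.
elim: r => [|x r IH]; first by rewrite big_nil -[1]/(1%:M) -mono1;
  apply: mono_eq => // S; rewrite big_nil.
rewrite big_cons IH -mulmxE mono_mul; apply: mono_eq => // S.
by rewrite big_cons.
Qed.

(** The Jordan-Wigner sign of mode [m] in the state |S>. *)
Definition jw m S : R[i] := (-1) ^+ #|[set j in S | enum_rank j < enum_rank m]%N|.

Lemma jw_sqr m S : jw m S * jw m S = 1.
Proof. by rewrite -expr2 sqrr_sign. Qed.

Lemma conjc_jw m S : conjc (jw m S) = jw m S.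
Proof. by rewrite /jw rmorph_sign. Qed.

Lemma jwD1 m m' S : m' \in S ->
  jw m (S :\ m') = (-1) ^+ (enum_rank m' < enum_rank m)%N * jw m S.
Proof.
move=> m'S; rewrite /jw.
have [lt|ge] := ltnP (enum_rank m') (enum_rank m).
  rewrite (cardsD1 m' [set j in S | _]%N) inE m'S lt /= expr1 add1n exprS.
  rewrite mulrA mulrNN mulr1 mul1r; congr (_ ^+ #|pred_of_set _|).
  by apply/setP=> j; rewrite !inE andbA.
rewrite mul1r; congr (_ ^+ #|pred_of_set _|).
apply/setP=> j; rewrite !inE; case: eqP => //= ->.
by rewrite ltnNge ge andbF.
Qed.

Lemma jwU1 m m' S : m' \notin S ->
  jw m (m' |: S) = (-1) ^+ (enum_rank m' < enum_rank m)%N * jw m S.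
Proof.
move=> m'S; rewrite -[in RHS](finset.setU1K m'S) jwD1 ?finset.setU11//.
by rewrite mulrA -expr2 sqrr_sign mul1r.
Qed.

Lemma ladderE m :
  ladder R m = mono (fun S => S :\ m) (fun S => jw m S *+ (m \in S)).
Proof.
by apply/matrixP=> r c; rewrite !mxE; case: (m \in _); case: (_ == _).
Qed.

Lemma adj_ladderE m :
  adj (ladder R m) = mono (fun S => m |: S) (fun S => jw m S *+ (m \notin S)).
Proof.
apply/matrixP=> r c; rewrite !mxE.
set A := bstate r; set B := bstate c.
have [/andP[mA /eqP BE]|] := boolP ((m \in A) && _).
  rewrite BE finset.setD1K // eqxx finset.in_setD1 eqxx /= jwD1 // ltnn mul1r.
  by rewrite conjc_jw mulr1n.
move=> H; rewrite conjc0; case: eqP => [AE|]; last by rewrite mulr0n.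
case: (boolP (m \in B)) => mB; first by rewrite mulr0n.
by case/negP: H; rewrite AE finset.setU11 setU1K ?eqxx.
Qed.

Lemma rank_lt_asym m m' : m != m' ->
  (enum_rank m' < enum_rank m)%N = ~~ (enum_rank m < enum_rank m')%N.
Proof.
move=> mm'; rewrite -leqNgt ltn_neqAle; case: eqP => // /val_inj/enum_rank_inj E.
by rewrite E eqxx in mm'.
Qed.

(** Both orders remove the same two modes. Exactly one of two distinct modes precedes the other, so
    removing one first flips exactly one Jordan-Wigner sign. *)
Lemma ladder_anticomm m m' :
  ladder R m *m ladder R m' + ladder R m' *m ladder R m = 0.
Proof.
rewrite !ladderE !mono_mul.
have -> : mono ((fun S => S :\ m') \o (fun S => S :\ m))
   (fun S => (jw m' (S :\ m) *+ (m' \in S :\ m)) * (jw m S *+ (m \in S))) =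
   mono ((fun S => S :\ m) \o (fun S => S :\ m'))
   (fun S => (jw m' (S :\ m) *+ (m' \in S :\ m)) * (jw m S *+ (m \in S))).
  by apply: mono_eq => // S _ /=; rewrite !finset.setDDl finset.setUC.
rewrite mono_add mono0 // => S; rewrite !inE.
have [->|mm'] := eqVneq m m'; first by rewrite /= ?mulr0n ?mul0r ?addr0.
rewrite /=.
case: (boolP (m \in S)) => mS; case: (boolP (m' \in S)) => m'S;
  rewrite ?mulr0n ?mulr0 ?mul0r ?addr0 // !mulr1n !jwD1 //.
rewrite rank_lt_asym //; case: (_ < _)%N; rewrite ?expr0 ?expr1; ring.
Qed.

(** For equal modes the two products are the complementary projections onto [m] empty and [m]
    occupied; for distinct modes the sign argument for two annihilators applies. *)
Lemma ladder_adj_anticomm m m' :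
  ladder R m *m adj (ladder R m') + adj (ladder R m') *m ladder R m
  = (m == m')%:R%:M.
Proof.
rewrite !adj_ladderE !ladderE !mono_mul.
have [<-|mm'] := eqVneq m m'.
  have -> : mono ((fun S => S :\ m) \o (fun S => m |: S))
     (fun S => (jw m (m |: S) *+ (m \in m |: S)) * (jw m S *+ (m \notin S)))
     = mono id (fun S => (m \notin S)%:R).
    apply: mono_eq => S /=; have [mS|mS] := boolP (m \in S);
      rewrite ?mulr0n ?mulr0 ?eqxx //; last by rewrite finset.setU1K.
    by rewrite finset.setU11 jwU1 // ltnn mul1r !mulr1n jw_sqr.
  have -> : mono ((fun S => m |: S) \o (fun S => S :\ m))
     (fun S => (jw m (S :\ m) *+ (m \notin S :\ m)) * (jw m S *+ (m \in S)))
     = mono id (fun S => (m \in S)%:R).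
    apply: mono_eq => S /=; have [mS|mS] := boolP (m \in S);
      rewrite ?mulr0n ?mulr0 ?eqxx //; last by rewrite finset.setD1K.
    by rewrite finset.setD11 jwD1 // ltnn mul1r !mulr1n jw_sqr.
  rewrite -mono1.
  rewrite mono_add; apply: mono_eq => // S.
  by case: (m \in S); rewrite ?addr0 ?add0r.
have -> : mono ((fun S => m' |: S) \o (fun S => S :\ m))
   (fun S => (jw m' (S :\ m) *+ (m' \notin S :\ m)) * (jw m S *+ (m \in S))) =
   mono ((fun S => S :\ m) \o (fun S => m' |: S))
   (fun S => (jw m' (S :\ m) *+ (m' \notin S :\ m)) * (jw m S *+ (m \in S))).
  apply: mono_eq => // S _ /=; apply/setP=> j; rewrite !inE.
  by case: (eqVneq j m') => //= ->; rewrite eq_sym mm'.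
rewrite mono_add mono0 ?mulr0n ?raddf0 // => S; rewrite !inE.
rewrite (negPf mm') eq_sym mm' /=.
case: (boolP (m \in S)) => mS; case: (boolP (m' \in S)) => m'S;
  rewrite ?mulr0n ?mulr0 ?mul0r ?addr0 // !mulr1n jwD1 // jwU1 //.
rewrite rank_lt_asym //; case: (_ < _)%N; rewrite ?expr0 ?expr1; ring.
Qed.

(** The projector |0><0| stands in for the vacuum vector, which keeps every argument inside the
    operator algebra. *)
Definition vacuum : op R M :=
  delta_mx (enum_rank (finset.set0 : {set M})) (enum_rank (finset.set0 : {set M})).

Lemma ladder_mul_adj m :
  ladder R m *m adj (ladder R m) = mono id (fun S => (m \notin S)%:R).
Proof.
rewrite adj_ladderE ladderE mono_mul; apply: mono_eq => S /=.
  case: (boolP (m \in S)) => mS; first by rewrite mulr0n mulr0.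
  by rewrite finset.setU11 jwU1 // ltnn mul1r !mulr1n jw_sqr.
case: (boolP (m \in S)) => mS; last by rewrite finset.setU1K.
by rewrite mulr0n mulr0 eqxx.
Qed.

(** Each factor projects onto the states with [m] empty. In this form the vacuum projector can be
    transported by a homomorphism known only on ladder operators. *)
Lemma vacproj : \prod_m (ladder R m *m adj (ladder R m)) = vacuum.
Proof.
under eq_bigr do rewrite ladder_mul_adj.
rewrite mono_prod; apply/matrixP=> r c; rewrite !mxE.
rewrite -!(can2_eq (@enum_valK _) (@enum_rankK _)) -/(bstate r) -/(bstate c).
have [->|/finset.set0Pn[m mS]] := eqVneq (bstate c) finset.set0.
  by rewrite andbT big1 // => m _; rewrite inE.
by rewrite andbF (bigD1 m) //= mS mul0r mul0rn.
Qed.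

End Monomial.

(** * Algebra of the conjugate transpose *)

Section Adjoint.
Variables (R : realType) (n : nat).
Implicit Types (A B : 'M[R[i]]_n) (c : R[i]).

Lemma adjointE A : adj A = (map_mx conjc A)^T.
Proof. by apply/matrixP=> r c; rewrite !mxE. Qed.

Lemma adjointK A : adj (adj A) = A.
Proof. by apply/matrixP=> r c; rewrite !mxE conjcK. Qed.

Lemma adjointD A B : adj (A + B) = adj A + adj B.
Proof. by apply/matrixP=> r c; rewrite !mxE rmorphD. Qed.

Lemma adjoint0 : adj (0 : 'M[R[i]]_n) = 0.
Proof. by apply/matrixP=> r c; rewrite !mxE rmorph0. Qed.

Lemma adjointZ c A : adj (c *: A) = conjc c *: adj A.
Proof. by apply/matrixP=> r s; rewrite !mxE rmorphM. Qed.

Lemma adjointM A B : adj (A *m B) = adj B *m adj A.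
Proof. by rewrite !adjointE map_mxM trmx_mul. Qed.

Lemma adjoint1 : adj (1%:M : 'M[R[i]]_n) = 1%:M.
Proof. by rewrite adjointE map_mx1 trmx1. Qed.

Lemma adj_sum (I : Type) (r : seq I) (P : pred I) (F : I -> 'M[R[i]]_n) :
  adj (\sum_(i <- r | P i) F i) = \sum_(i <- r | P i) adj (F i).
Proof. by apply: (big_morph (@adj R n)); [exact: adjointD | exact: adjoint0]. Qed.

Lemma adj_delta i j : adj (delta_mx i j : 'M[R[i]]_n) = delta_mx j i.
Proof. by apply/matrixP=> r s; rewrite !mxE rmorph_nat andbC. Qed.

End Adjoint.

(** * Generation of the operator algebra by ladder operators *)

Section Generators.
Variables (R : realType) (M : finType).
Implicit Types (m : M) (b : bool) (X Y : op R M).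

(** The boolean treats creators ([true]) and annihilators uniformly in all later inductions. *)
Definition gop b m : op R M := if b then adj (ladder R m) else ladder R m.

Lemma gop_anticomm b m b' m' :
  gop b m *m gop b' m' + gop b' m' *m gop b m =
  ((m == m') && (b != b'))%:R%:M.
Proof.
case: b; case: b'; rewrite /gop ?andbF ?andbT.
- by rewrite -!adjointM -adjointD addrC ladder_anticomm adjoint0 mulr0n raddf0.
- by rewrite addrC ladder_adj_anticomm eq_sym.
- by rewrite ladder_adj_anticomm.
- by rewrite ladder_anticomm mulr0n raddf0.
Qed.

(** Products enter only through left multiplication by one generator, so an induction peels off one
    generator at a time. *)
Inductive generated : op R M -> Prop :=
| generated1 : generated 1%:M
| generatedD X Y : generated X -> generated Y -> generated (X + Y)
| generatedZ (c : R[i]) X : generated X -> generated (c *: X)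
| generatedG b m X : generated X -> generated (gop b m *m X).

Let generated_gop b m : generated (gop b m).
Proof. rewrite -[gop b m]mulmx1; apply: generatedG; exact: generated1. Qed.

Let generatedM X Y : generated X -> generated Y -> generated (X *m Y).
Proof.
move=> gX gY; elim: gX => [|A B _ IA _ IB|c A _ IA|b m A _ IA].
- by rewrite mul1mx.
- by rewrite mulmxDl; apply: generatedD.
- by rewrite -scalemxAl; apply: generatedZ.
- by rewrite -mulmxA; apply: generatedG.
Qed.

Let generated_adj X : generated X -> generated (adj X).
Proof.
elim=> [|A B _ IA _ IB|c A _ IA|b m A _ IA].
- rewrite adjoint1; exact: generated1.
- by rewrite adjointD; apply: generatedD.
- by rewrite adjointZ; apply: generatedZ.
- rewrite adjointM; apply: generatedM => //.
  have -> : adj (gop b m) = gop (~~ b) m by case: b; rewrite /= ?adjointK.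
  exact: generated_gop.
Qed.

(** Induction on the number of particles: |0><0| is a product of generators, and the creator of some
    [m] in [S] raises |S - m><0| to |S><0| up to a sign, which the scalar [jw] cancels. *)
Let generated_delta0 (S : {set M}) :
  generated (delta_mx (enum_rank S) (enum_rank finset.set0)).
Proof.
move E: #|S| => k; elim: k S E => [|k IH] S E.
  move/eqP: E; rewrite finset.cards_eq0 => /eqP->; rewrite -/(vacuum R M) -vacproj.
  apply: (big_ind generated) => [|X Y gX gY|m _].
  - exact: generated1.
  - by rewrite -mulmxE; apply: generatedM.
  - by have := generatedG false m (generated_gop true m).
have /card_gt0P[m mS] : (0 < #|S|)%N by rewrite E.
have Sk : #|S :\ m| = k.
  by apply: succn_inj; rewrite -E (finset.cardsD1 m S) mS.
have := generatedZ (jw R m (S :\ m)) (generatedG true m (IH _ Sk)).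
rewrite /= adj_ladderE mono_delta finset.setD1K // finset.setD11 mulr1n.
by rewrite scalerA jw_sqr scale1r.
Qed.

(** Every matrix unit is |S><0| times the adjoint of some |S'><0|. *)
Lemma generatedT X : generated X.
Proof.
rewrite (matrix_sum_delta X).
have g0 : generated 0 by rewrite -(scale0r 1%:M); apply/generatedZ/generated1.
apply: (big_ind generated) => // [|i _]; first exact: generatedD.
apply: (big_ind generated) => // [|j _]; first exact: generatedD.
apply: generatedZ.
rewrite -(mul_delta_mx (enum_rank (finset.set0 : {set M}))).
rewrite -(enum_valK i) -(enum_valK j).
apply: generatedM; first exact: generated_delta0.
by rewrite -adj_delta; apply/generated_adj/generated_delta0.
Qed.

(** By generation [X] commutes with everything. In |i><i| = |i><0| |0><0| |0><i| it can thus be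
    moved next to |0><0|, where it is absorbed. *)
Lemma comm_gop_scalar X : (forall b m, gop b m *m X = X *m gop b m) ->
  X *m vacuum R M = vacuum R M ->
  X = 1%:M.
Proof.
move=> cX; rewrite /vacuum => X0.
have {}cX Y : Y *m X = X *m Y.
  elim: (generatedT Y) => [|A B _ IA _ IB|c A _ IA|b m A _ IA].
  - by rewrite mulmx1 mul1mx.
  - by rewrite mulmxDl mulmxDr IA IB.
  - by rewrite -scalemxAl -scalemxAr IA.
  - by rewrite -mulmxA IA !mulmxA cX.
move: X0; set e : 'I_(fdim M) := enum_rank finset.set0 => X0.
rewrite -[LHS]mulmx1 mx1_sum_delta mulmx_sumr; apply: eq_bigr => i _.
rewrite -(mul_delta_mx e) -(mul_delta_mx e e i).
by rewrite !mulmxA -cX -[_ *m X *m _]mulmxA X0.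
Qed.

End Generators.

(** * Complex limits and the exponential series on the imaginary axis *)

Section ComplexLimits.
Variable R : realType.
Local Open Scope classical_set_scope.

(** Real and imaginary parts are separated to match the limits in [mxexp]. *)
Definition cvgC (u : nat -> R[i]) (l : R[i]) : Prop :=
  ((fun K => complex.Re (u K)) @ \oo --> complex.Re l) /\
  ((fun K => complex.Im (u K)) @ \oo --> complex.Im l).

Lemma cvgC_cst l : cvgC (fun=> l) l.
Proof. by split; apply: cvg_cst. Qed.

Lemma cvgCD u v l k : cvgC u l -> cvgC v k -> cvgC (fun K => u K + v K) (l + k).
Proof.
move=> [ul1 ul2] [vk1 vk2]; split; rewrite raddfD /=.
  under eq_fun do rewrite raddfD /=.
  exact: cvgD.
under eq_fun do rewrite raddfD /=.
exact: cvgD.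
Qed.

Lemma cvgCZ a u l : cvgC u l -> cvgC (fun K => a * u K) (a * l).
Proof.
have ReM x y : complex.Re (x * y : R[i]) =
    complex.Re x * complex.Re y - complex.Im x * complex.Im y.
  by case: x; case: y.
have ImM x y : complex.Im (x * y : R[i]) =
    complex.Re x * complex.Im y + complex.Im x * complex.Re y.
  by case: x; case: y.
move=> [ul1 ul2]; split.
  rewrite ReM; under eq_fun do rewrite ReM.
  by apply: cvgB; apply: cvgMr.
rewrite ImM; under eq_fun do rewrite ImM.
by apply: cvgD; apply: cvgMr.
Qed.

Lemma cvgC_sum (I : Type) (r : seq I) (u : I -> nat -> R[i]) (l : I -> R[i]) :
  (forall i, cvgC (u i) (l i)) ->
  cvgC (fun K => \sum_(i <- r) u i K) (\sum_(i <- r) l i).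
Proof.
move=> ul; elim: r => [|i r IH].
  by rewrite big_nil; under eq_fun do rewrite big_nil; exact: cvgC_cst.
by rewrite big_cons; under eq_fun do rewrite big_cons; exact: cvgCD.
Qed.

Lemma cvgC_unique u l k : cvgC u l -> cvgC u k -> l = k.
Proof.
case: l k => [a b] [c d] [/= ua ub] [/= uc ud].
by congr (_ +i* _); [exact: cvg_unique ua uc | exact: cvg_unique ub ud].
Qed.

Lemma expi_coeff (x : R) j :
  (j`!)%:R^-1 * (0 +i* x) ^+ j = cos_coeff x j +i* sin_coeff x j.
Proof.
(* Even powers of ix are real and feed the cosine series, odd powers are imaginary and feed the sine
   series. *)
have -> : (0 +i* x) ^+ j = ((~~ odd j)%:R * (-1) ^+ j./2 * x ^+ j)
    +i* ((odd j)%:R * (-1) ^+ j.-1./2 * x ^+ j).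
  have E k : (0 +i* x) ^+ k.*2 = ((-1) ^+ k * x ^+ k.*2)%:C.
    rewrite -mul2n !exprM -exprMn mulN1r rmorphXn /=; congr (_ ^+ _).
    by rewrite !expr2; simpc.
  rewrite -(odd_double_half j); move: (odd j) (j./2) => [] k.
    rewrite add1n /= odd_double /= doubleK exprSr E uphalf_double exprS.
    by simpc; rewrite mulrAC mulrA [_ * x]mulrC.
  by rewrite add0n /= odd_double /= doubleK E; simpc.
have -> : ((j`!)%:R^-1 : R[i]) = ((j`!)%:R^-1)%:C.
  by rewrite fmorphV rmorph_nat.
rewrite /cos_coeff /sin_coeff /=; simpc.
by congr (_ +i* _); rewrite -?exprnP; ring.
Qed.

Lemma cvgC_expi (x : R) :
  cvgC (fun K => \sum_(j < K) ((j`!)%:R^-1 * (0 +i* x) ^+ j)) (expi x).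
Proof.
have E K : \sum_(j < K) ((j`!)%:R^-1 * (0 +i* x) ^+ j) =
    series (cos_coeff x) K +i* series (sin_coeff x) K.
  rewrite /series /= !big_mkord; elim/big_ind3: _ => // [|j _].
    by move=> a b [c d] e f [g h] [-> ->] [-> ->].
  exact: expi_coeff.
under eq_fun do rewrite E.
(* Unlocked, [cos] and [sin] are the limits of these very series, so their convergence suffices. *)
split => /=; rewrite unlock.
  exact: is_cvg_series_cos_coeff.
exact: is_cvg_series_sin_coeff.
Qed.

Lemma expi0 : expi 0 = 1 :> R[i].
Proof. by rewrite /expi cos0 sin0. Qed.

Lemma expiD (x y : R) : expi (x + y) = expi x * expi y.
Proof.
rewrite /expi cosD sinD; simpc.
by congr (_ +i* _); rewrite addrC.
Qed.

Lemma conjc_expi (x : R) : conjc (expi x) = expi (- x).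
Proof. by rewrite /expi cosN sinN. Qed.

End ComplexLimits.

(** * Matrix exponentials: intertwining relations and imaginary shifts *)

Section Exponential.
Variables (R : realType) (n : nat).
Implicit Types (A B V W X Y : 'M[R[i]]_n) (c th : R).

Definition mxcvg (u : nat -> 'M[R[i]]_n) V := forall r s,
  cvgC (fun K => u K r s) (V r s).

Lemma mxcvg_eq u v V : u =1 v -> mxcvg u V -> mxcvg v V.
Proof. by move=> /funext ->. Qed.

Lemma mxcvg_unique u V W : mxcvg u V -> mxcvg u W -> V = W.
Proof. by move=> uV uW; apply/matrixP=> r s; apply: cvgC_unique (uV r s) (uW r s). Qed.

Lemma mxcvgD u v V W : mxcvg u V -> mxcvg v W ->
  mxcvg (fun K => u K + v K) (V + W).
Proof.
move=> uV vW r s; rewrite mxE; under eq_fun do rewrite mxE.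
exact: cvgCD.
Qed.

Lemma mxcvgMl X u V : mxcvg u V -> mxcvg (fun K => X *m u K) (X *m V).
Proof.
move=> uV r s; rewrite mxE; under eq_fun do rewrite mxE.
by apply: cvgC_sum => k; apply: cvgCZ.
Qed.

Lemma mxcvgMr X u V : mxcvg u V -> mxcvg (fun K => u K *m X) (V *m X).
Proof.
move=> uV r s; rewrite mxE; under eq_fun do rewrite mxE.
apply: cvgC_sum => k; rewrite mulrC; under eq_fun do rewrite mulrC.
exact: cvgCZ.
Qed.

Definition mxexp_to A V := mxcvg (mx_psum A) V.

Lemma mxexp_toE A V : mxexp_to A V -> mxexp A = V.
Proof.
move=> AV; apply/matrixP=> r s; rewrite mxE.
have [/cvg_lim/= -> // /cvg_lim/= -> //] := AV r s.
by case: (V r s).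
Qed.

Lemma mx_psum_intertwine A B X K : A *m X = X *m B ->
  mx_psum A K *m X = X *m mx_psum B K.
Proof.
move=> AX; rewrite mulmx_suml mulmx_sumr; apply: eq_bigr => -[j _] _ /=.
rewrite -scalemxAl -scalemxAr; congr (_ *: _).
elim: j => [|j IH]; first by rewrite !expr0 -[1]/(1%:M) mul1mx mulmx1.
by rewrite !exprSr -!mulmxE -mulmxA AX mulmxA IH mulmxA.
Qed.

(** A^j X = X B^j holds for all powers, hence for partial sums and for their limits. *)
Lemma mxexp_to_intertwine A B V W X : mxexp_to A V -> mxexp_to B W ->
  A *m X = X *m B -> V *m X = X *m W.
Proof.
move=> AV BW AX; apply: (@mxcvg_unique (fun K => mx_psum A K *m X)).
  exact: mxcvgMr.
apply: mxcvg_eq (mxcvgMl X BW) => K.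
by rewrite (mx_psum_intertwine _ AX).
Qed.

(* Adding an imaginary scalar to the exponent multiplies the exponential by a
   phase; this is the only instance of exp(A + B) = exp A exp B that is needed,
   and it is carried along instead of being derived from Cauchy products. *)
Definition phase_exp A V := forall c,
  mxexp_to (A + (0 +i* c)%:M) (expi c *: V).

Lemma phase_expE A V : phase_exp A V -> mxexp_to A V.
Proof. by move=> /(_ 0); rewrite expi0 scale1r raddf0 addr0. Qed.

Lemma phase_exp0 : phase_exp 0 1%:M.
Proof.
move=> c r s; rewrite add0r.
have E K : mx_psum (0 +i* c)%:M K r s =
    (r == s)%:R * \sum_(j < K) ((j`!)%:R^-1 * (0 +i* c) ^+ j).
  rewrite /mx_psum summxE mulr_sumr; apply: eq_bigr => j _.
  by rewrite -rmorphXn /= !mxE mulrnAr mulr_natl.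
under eq_fun do rewrite E.
rewrite !mxE -[1 *+ _]/((r == s)%:R) mulrC.
by apply: cvgCZ; exact: cvgC_expi.
Qed.

(** The projection [N] splits the space into two parts stable under [A]: on its range the exponent
    is [A] shifted by the scalar i th, on its kernel it is [A] itself. *)
Lemma phase_expD A V N th : phase_exp A V -> N *m N = N -> A *m N = N *m A ->
  phase_exp (A + (0 +i* th) *: N) (V *m (1%:M - N + expi th *: N)).
Proof.
move=> AV NN AN c.
set X := A + _ + _; pose B d := A + (0 +i* d)%:M.
have BN d : B d *m N = N *m B d.
  by rewrite mulmxDl mulmxDr AN scalar_mxC.
have XN : X *m N = N *m B (c + th).
  rewrite -BN /X /B -addrA !mulmxDl -scalemxAl NN; congr (_ + _).
  rewrite !mul_scalar_mx -scalerDl; congr (_ *: _).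
  by simpc; rewrite addrC.
have XN' : X *m (1%:M - N) = (1%:M - N) *m B c.
  rewrite mulmxBl mulmxBr mul1mx mulmx1 -BN /X /B.
  rewrite !mulmxDl -[(_ *: N) *m N]scalemxAl NN.
  by rewrite [A + _ + _]addrAC [_ *m N + _ + _]addrAC opprD addrACA subrr addr0.
have E : expi c *: (V *m (1%:M - N + expi th *: N)) =
    (1%:M - N) *m (expi c *: V) + N *m (expi (c + th) *: V).
  have VN : V *m N = N *m V.
    exact: mxexp_to_intertwine (phase_expE AV) (phase_expE AV) AN.
  rewrite mulmxDr mulmxBr mulmx1 -!scalemxAr mulmxBl mul1mx VN.
  by rewrite scalerDr scalerA -expiD.
rewrite E.
apply: mxcvg_eq (mxcvgD (mxcvgMl _ (AV c)) (mxcvgMl _ (AV (c + th)))) => K.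
by rewrite -(mx_psum_intertwine _ XN) -(mx_psum_intertwine _ XN') -mulmxDr subrK mulmx1.
Qed.

(** Commuting projections are added one by one. Only existence of the exponential is recorded; its
    properties come from intertwining relations. *)
Lemma phase_exp_sum (I : Type) (r : seq I) (N : I -> 'M[R[i]]_n) (th : I -> R) :
  (forall i, N i *m N i = N i) -> (forall i j, N i *m N j = N j *m N i) ->
  exists V, phase_exp (\sum_(i <- r) (0 +i* th i) *: N i) V.
Proof.
move=> NN NC; elim: r => [|i r [V IH]].
  by rewrite big_nil; exists 1%:M; exact: phase_exp0.
rewrite big_cons addrC; eexists; apply: phase_expD => //.
rewrite mulmx_suml mulmx_sumr; apply: eq_bigr => j _.
by rewrite -scalemxAl -scalemxAr NC.
Qed.

Lemma mxexp_shift A V X th : phase_exp A V ->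
  A *m X = X *m (A + (0 +i* th)%:M) ->
  mxexp A *m X = expi th *: (X *m mxexp A).
Proof.
move=> AV AX; rewrite (mxexp_toE (phase_expE AV)) scalemxAr.
exact: mxexp_to_intertwine (phase_expE AV) (AV th) AX.
Qed.

(** Here [X] intertwines [A] with the zero matrix, whose exponential is 1. *)
Lemma mxexp_kernel A V X : phase_exp A V -> A *m X = 0 -> mxexp A *m X = X.
Proof.
move=> AV AX; rewrite (mxexp_toE (phase_expE AV)) -[RHS]mulmx1.
by apply: mxexp_to_intertwine (phase_expE AV) (phase_expE phase_exp0) _; rewrite mulmx0.
Qed.

End Exponential.

(** * Exponentials of number operators, for any family of fermionic modes *)

Section QuadraticExponential.
Variables (R : realType) (n : nat) (I : finType) (b : I -> 'M[R[i]]_n).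
Hypothesis anticomm : forall i j, b i *m b j + b j *m b i = 0.
Hypothesis anticomm_adj : forall i j,
  b i *m adj (b j) + adj (b j) *m b i = (i == j)%:R%:M.

Let N i := adj (b i) *m b i.

Lemma number_annihilate i k : N i *m b k = b k *m (N i - (i == k)%:R%:M).
Proof.
have H1 : b i *m b k = - (b k *m b i) by apply/eqP; rewrite -addr_eq0 anticomm.
have H2 : adj (b i) *m b k = (i == k)%:R%:M - b k *m adj (b i).
  by rewrite eq_sym -anticomm_adj addrAC subrr add0r.
rewrite /N -mulmxA H1 mulmxN mulmxA H2 mulmxBl mulmxBr opprB -mulmxA.
by congr (_ - _); rewrite mul_scalar_mx mul_mx_scalar; case: eqP => [->//|_]; rewrite !scale0r.
Qed.

Lemma number_create i k :
  N i *m adj (b k) = adj (b k) *m (N i + (i == k)%:R%:M).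
Proof.
have H1 : adj (b i) *m adj (b k) = - (adj (b k) *m adj (b i)).
  by apply/eqP; rewrite -addr_eq0 -!adjointM -adjointD addrC anticomm adjoint0.
have H2 : b i *m adj (b k) = (i == k)%:R%:M - adj (b k) *m b i.
  by rewrite -anticomm_adj addrK.
rewrite /N -mulmxA H2 mulmxBr mulmxDr [in RHS]mulmxA [in LHS]mulmxA H1 mulNmx opprK addrC.
by congr (_ + _); rewrite !mul_mx_scalar; case: eqP => [->//|_]; rewrite !scale0r.
Qed.

Lemma number_idem i : N i *m N i = N i.
Proof.
have b2 : b i *m b i = 0.
  apply/eqP; rewrite -(inj_eq (@scalerI _ _ 2%:R _)) ?pnatr_eq0 //.
  by rewrite scaler0 scaler_nat mulr2n anticomm.
rewrite {2}/N mulmxA number_create eqxx -mulmxA mulmxDl mul1mx.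
by rewrite -[N i *m b i]mulmxA b2 mulmx0 add0r.
Qed.

(** Moving the creator and then the annihilator of mode j past [N i] produces two Kronecker terms
    that cancel. *)
Lemma number_comm i j : N i *m N j = N j *m N i.
Proof.
rewrite {2}/N mulmxA number_create -mulmxA mulmxDl number_annihilate mulmxBr.
by rewrite mul_scalar_mx mul_mx_scalar subrK mulmxA.
Qed.

Variable th : I -> R.
Let Z := \sum_i (0 +i* th i) *: N i.

Lemma quadratic_phase_exp : exists V, phase_exp Z V.
Proof. by apply: phase_exp_sum; [exact: number_idem | exact: number_comm]. Qed.

(** The annihilator shifts its own number operator by one and commutes with the others, so it
    intertwines [Z] with [Z] shifted by -i th_k. *)
Lemma mxexp_annihilate k :
  mxexp Z *m b k = expi (- th k) *: (b k *m mxexp Z).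
Proof.
have [V ZV] := quadratic_phase_exp; apply: (mxexp_shift ZV).
rewrite /Z mulmxDr mulmx_suml mulmx_sumr (bigD1 k) //= [in RHS](bigD1 k) //=.
rewrite -!scalemxAl number_annihilate eqxx -!scalemxAr mulmxBr scalerBr.
rewrite mulmx1 mul_mx_scalar addrAC.
congr (_ + _); last by rewrite -scaleNr; congr (_ *: _); simpc.
congr (_ + _); apply: eq_bigr => i ik.
by rewrite -scalemxAl -scalemxAr number_annihilate (negPf ik) raddf0 subr0.
Qed.

Lemma mxexp_create k :
  mxexp Z *m adj (b k) = expi (th k) *: (adj (b k) *m mxexp Z).
Proof.
have [V ZV] := quadratic_phase_exp; apply: (mxexp_shift ZV).
rewrite /Z mulmxDr mulmx_suml mulmx_sumr (bigD1 k) //= [in RHS](bigD1 k) //=.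
rewrite -!scalemxAl number_create eqxx -!scalemxAr mulmxDr scalerDr.
rewrite mulmx1 mul_mx_scalar addrAC.
congr (_ + _); congr (_ + _); apply: eq_bigr => i ik.
by rewrite -scalemxAl -scalemxAr number_create (negPf ik) raddf0 addr0.
Qed.

Lemma mxexp_vacuum (X : 'M[R[i]]_n) : (forall i, b i *m X = 0) -> mxexp Z *m X = X.
Proof.
have [V ZV] := quadratic_phase_exp => bX; apply: (mxexp_kernel ZV).
rewrite /Z mulmx_suml big1 // => i _.
by rewrite -scalemxAl /N -mulmxA bX mulmx0 scaler0.
Qed.

(** In each term of [Z] the signs from the creator and the annihilator cancel. The intended [X] is
    the parity. *)
Lemma mxexp_even X : (forall i, X *m b i = - (b i *m X)) ->
  (forall i, X *m adj (b i) = - (adj (b i) *m X)) ->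
  mxexp Z *m X = X *m mxexp Z.
Proof.
have [V ZV] := quadratic_phase_exp => bX aX.
rewrite (mxexp_toE (phase_expE ZV)).
apply: mxexp_to_intertwine (phase_expE ZV) (phase_expE ZV) _.
rewrite /Z mulmx_suml mulmx_sumr; apply: eq_bigr => i _.
rewrite -scalemxAl -scalemxAr; congr (_ *: _).
by rewrite /N mulmxA aX mulNmx -!mulmxA bX mulmxN opprK.
Qed.

End QuadraticExponential.

(** * The parity operator *)

Section Parity.
Variables (R : realType) (M : finType).
Implicit Types (m : M) (b : bool).
Let P := parity R M.

Lemma expi_pi : expi pi = -1 :> R[i].
Proof. by rewrite /expi cospi sinpi; apply/eqP; rewrite eq_complex /= oppr0 !eqxx. Qed.

Lemma ladder_vacuum m : ladder R m *m vacuum R M = 0.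
Proof.
by rewrite ladderE /vacuum mono_delta finset.in_set0 mulr0n scale0r.
Qed.

Lemma trace_vacuum : \tr (vacuum R M) = 1.
Proof.
rewrite /mxtrace (bigD1 (enum_rank (finset.set0 : {set M}))) //= mxE !eqxx.
by rewrite big1 ?addr0 // => i /negPf iN; rewrite mxE iN.
Qed.

(** Exhibits the parity as a quadratic exponential with all phases equal to pi, so each generator
    crosses it with the factor -1. *)
Let parityE :
  P = mxexp (\sum_m (0 +i* (pi : R)) *: (adj (ladder R m) *m ladder R m)).
Proof.
rewrite /P /parity /numop scaler_sumr; congr (mxexp _).
by apply: eq_bigr => m _; congr (_ *: _); simpc.
Qed.

Lemma parity_gop b m : P *m gop R b m = - (gop R b m *m P).
Proof.
rewrite parityE; case: b => /=.
  rewrite (mxexp_create (@ladder_anticomm R M) (@ladder_adj_anticomm R M)).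
  by rewrite expi_pi scaleN1r.
rewrite (mxexp_annihilate (@ladder_anticomm R M) (@ladder_adj_anticomm R M)).
by rewrite -conjc_expi expi_pi rmorphN1 scaleN1r.
Qed.

Lemma parity_ladder m : P *m ladder R m = - (ladder R m *m P).
Proof. exact: parity_gop false m. Qed.

Lemma parity_adj_ladder m : P *m adj (ladder R m) = - (adj (ladder R m) *m P).
Proof. exact: parity_gop true m. Qed.

Lemma parity_vacuum : P *m vacuum R M = vacuum R M.
Proof.
rewrite parityE.
by apply: (mxexp_vacuum (@ladder_anticomm R M) (@ladder_adj_anticomm R M)) => m;
  exact: ladder_vacuum.
Qed.

(** The two signs cancel, so the square commutes with all generators; it also fixes the vacuum. *)
Lemma parity_sqr : P *m P = 1%:M.
Proof.
apply: comm_gop_scalar => [b m|]; last by rewrite -mulmxA !parity_vacuum.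
by rewrite -[RHS]mulmxA parity_gop mulmxN [in RHS]mulmxA parity_gop mulNmx opprK mulmxA.
Qed.

Lemma invmx_parity : invmx P = P.
Proof.
have /mulmx1_unit[uP _] := parity_sqr.
by rewrite -[RHS]mulmx1 -(mulmxV uP) mulmxA parity_sqr mul1mx.
Qed.

End Parity.

(** * Phases and roots of unity *)

Section RootsOfUnity.
Variable R : realType.

Lemma conjcM (x y : R[i]) : conjc (x * y) = conjc x * conjc y.
Proof. exact: rmorphM. Qed.

Lemma expiX (x : R) k : expi (x * k%:R) = expi x ^+ k.
Proof.
elim: k => [|k IH]; first by rewrite mulr0 expi0 expr0.
by rewrite -addn1 natrD mulrDr mulr1 expiD IH addn1 exprSr.
Qed.

(** The real part is 1 - 2 sin^2 x, which is below 1. *)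
Lemma expi_neq1 (x : R) : 0 < x < pi -> expi (x *+ 2) != 1.
Proof.
move=> /sin_gt0_pi s0; rewrite eq_complex negb_and /=; apply/orP; left.
rewrite cos_mulr2n cos2sin2 lt_eqF // mulrnBl mulr2n addrAC addrK.
by rewrite gtrDl oppr_lt0 mulrn_wgt0 // exprn_gt0.
Qed.

Lemma geometric_root_sum (z : R[i]) n : z ^+ n = 1 -> z != 1 ->
  \sum_(k < n) z ^+ k = 0.
Proof.
move=> zn z1; apply/eqP; have := subrX1 z n; rewrite zn subrr => /esym/eqP.
by rewrite mulf_eq0 subr_eq0 (negPf z1).
Qed.

End RootsOfUnity.

Lemma sum_kronecker (K : pzRingType) (V : lmodType K) (I : finType)
  (f : I -> V) t : \sum_s (t == s)%:R *: f s = f t.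
Proof.
rewrite (bigD1 t) //= eqxx scale1r big1 ?addr0 // => s st.
by rewrite eq_sym (negPf st) scale0r.
Qed.

(** * Discrete Fourier transform in time and the translation operator *)

Section TimeTranslation.
Variables (R : realType) (N L : nat) (eps : R).
Hypothesis (N_gt0 : (0 < N)%N) (eps_gt0 : 0 < eps).

(** The coefficients of [ahat]. The time [k] is any natural number, so that the fictitious slice N,
    one past the last, makes sense. *)
Definition dft (n k : nat) : R[i] :=
  ((Num.sqrt (N%:R : R))^-1)%:C * expi (omega N eps n * eps * k%:R).

Let Nr_gt0 : 0 < N%:R :> R. Proof. by rewrite ltr0n. Qed.

Lemma omega_eps n : omega N eps n * eps = (2 * n + 1)%:R * pi / N%:R.
Proof. rewrite /omega; field; by rewrite !lt0r_neq0. Qed.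

Lemma dft_shift n k : conjc (dft n k.+1) = conjc (dft n k) * expi (- (omega N eps n * eps)).
Proof.
by rewrite /dft -[k.+1]addn1 natrD mulrDr mulr1 expiD !conjcM !conjc_expi mulrA.
Qed.

Lemma expi_odd n : expi ((2 * n + 1)%:R * pi : R) = -1.
Proof.
rewrite mulrC expiX expi_pi addn1 exprS exprM sqrrN expr1n expr1n.
by rewrite mulr1.
Qed.

Lemma dft_antiperiodic n : dft n N = - dft n 0.
Proof.
rewrite /dft omega_eps mulr0 expi0 mulfVK ?lt0r_neq0 // expi_odd.
by rewrite mulrN.
Qed.

(** For m < n the phase is 2 pi (n - m) / N, strictly between 0 and 2 pi; the other case follows by
    conjugation. *)
Lemma expi_diff_neq1 (n m : 'I_N) : n != m ->
  expi (omega N eps n * eps - omega N eps m * eps) != 1.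
Proof.
wlog: n m / (m < n)%N => [H nm|mn _].
  case: (ltngtP m n) => [mn|mn|/val_inj E]; first exact: H.
    have := H m n mn; rewrite eq_sym nm => /(_ isT); apply: contra => /eqP E.
    by rewrite -opprB -conjc_expi E rmorph1.
  by rewrite E eqxx in nm.
rewrite !omega_eps.
have -> : (2 * n + 1)%:R * pi / N%:R - (2 * m + 1)%:R * pi / N%:R =
    (pi * (n - m)%:R / N%:R) *+ 2 :> R.
  by rewrite natrB ?(ltnW mn) // !(natrD _ (2 * _)) !natrM; field; rewrite lt0r_neq0.
apply: expi_neq1; rewrite divr_gt0 ?mulr_gt0 ?pi_gt0 ?ltr0n ?subn_gt0 //=.
rewrite ltr_pdivrMr // ltr_pM2l ?pi_gt0 // ltr_nat.
by rewrite (leq_ltn_trans (leq_subr _ _)).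
Qed.

(** A geometric sum with ratio [z]. Its N-th power is (-1)(-1) = 1 because both frequencies are
    antiperiodic, and [z] differs from 1 unless n = m. *)
Lemma dft_orthonormal (n m : 'I_N) :
  \sum_(k < N) dft n k * conjc (dft m k) = (n == m)%:R.
Proof.
pose z := expi (omega N eps n * eps - omega N eps m * eps) : R[i].
have E k : dft n k * conjc (dft m k) = (N%:R^-1) * z ^+ k.
  rewrite /dft conjcM conjc_expi mulrACA -expiD -mulrBl expiX; congr (_ * _).
  rewrite conjc_real -rmorphM -invfM -expr2 sqr_sqrtr ?ler0n // fmorphV.
  by rewrite rmorph_nat.
under eq_bigr do rewrite E.
rewrite -mulr_sumr; have [nm|nm] := eqVneq n m.
  rewrite /z nm subrr expi0; under eq_bigr do rewrite expr1n.
  by rewrite sumr_const card_ord mulVf // pnatr_eq0 -lt0n.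
rewrite geometric_root_sum ?mulr0 // /z; last exact: expi_diff_neq1.
rewrite -expiX mulrBl !omega_eps !mulfVK ?lt0r_neq0 //.
by rewrite expiD -conjc_expi !expi_odd rmorphN1 mulrNN mulr1.
Qed.

(** A one-sided inverse of a square matrix is two-sided, so orthonormal rows give orthonormal
    columns. *)
Lemma dft_orthonormal_col (s t : 'I_N) :
  \sum_(n < N) conjc (dft n s) * dft n t = (s == t)%:R.
Proof.
pose F := \matrix_(n < N, k < N) dft n k.
pose G := \matrix_(k < N, n < N) conjc (dft n k).
have FG : F *m G = 1%:M.
  apply/matrixP=> n m; rewrite !mxE -dft_orthonormal.
  by apply: eq_bigr => k _; rewrite !mxE.
have /matrixP/(_ s t) := mulmx1C FG; rewrite !mxE => <-.
by apply: eq_bigr => k _; rewrite !mxE.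
Qed.

Lemma ahatE (n : 'I_N) (j : 'I_L) :
  ahat eps n j = \sum_(t < N) dft n t *: ladder R (t, j).
Proof. by rewrite /ahat scaler_sumr; apply: eq_bigr => t _; rewrite scalerA. Qed.

Lemma adj_ahatE (n : 'I_N) (j : 'I_L) :
  adj (ahat eps n j) = \sum_(t < N) conjc (dft n t) *: adj (ladder R (t, j)).
Proof. by rewrite ahatE adj_sum; apply: eq_bigr => t _; rewrite adjointZ. Qed.

Let anticomm_sum (p : nat) (f g : 'I_N -> R[i]) (A B : 'I_N -> 'M[R[i]]_p) :
  (\sum_t f t *: A t) *m (\sum_s g s *: B s) +
  (\sum_s g s *: B s) *m (\sum_t f t *: A t) =
  \sum_t \sum_s (f t * g s) *: (A t *m B s + B s *m A t).
Proof.
rewrite [X in X + _]mulmx_suml [X in _ + X]mulmx_sumr -big_split /=; apply: eq_bigr => t _.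
rewrite mulmx_sumr mulmx_suml -big_split /=; apply: eq_bigr => s _.
rewrite -!scalemxAl -!scalemxAr !scalerA [g s * _]mulrC.
by rewrite scalerDr.
Qed.

Lemma ahat_anticomm (i j : Hmodes N L) :
  ahat eps i.1 i.2 *m ahat eps j.1 j.2 + ahat eps j.1 j.2 *m ahat eps i.1 i.2 = 0.
Proof.
rewrite !ahatE anticomm_sum big1 // => t _; rewrite big1 // => s _.
by rewrite ladder_anticomm scaler0.
Qed.

Lemma ahat_adj_anticomm (i j : Hmodes N L) :
  ahat eps i.1 i.2 *m adj (ahat eps j.1 j.2) +
  adj (ahat eps j.1 j.2) *m ahat eps i.1 i.2 = (i == j)%:R%:M.
Proof.
rewrite ahatE adj_ahatE anticomm_sum.
transitivity (\sum_(t < N) (dft i.1 t * conjc (dft j.1 t)) *: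
    ((i.2 == j.2)%:R%:M : op R (Hmodes N L))).
  apply: eq_bigr => t _; rewrite (bigD1 t) //= big1 ?addr0 => [|s st].
    by rewrite ladder_adj_anticomm xpair_eqE eqxx.
  rewrite ladder_adj_anticomm xpair_eqE eq_sym (negPf st).
  by rewrite raddf0 scaler0.
rewrite -scaler_suml dft_orthonormal scale_scalar_mx -natrM mulnb.
by case: i j => [i1 i2] [j1 j2].
Qed.

Let U := mxexp (((0 +i* 1) * eps%:C) *: @Pmom R N L eps).

Let UE : U = mxexp (\sum_(i : Hmodes N L) (0 +i* (omega N eps i.1 * eps)) *:
  (adj (ahat eps i.1 i.2) *m ahat eps i.1 i.2)).
Proof.
rewrite /U /Pmom pair_bigA /= scaler_sumr; congr (mxexp _).
apply: eq_bigr => -[n j] _ /=; rewrite scalerA; congr (_ *: _).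
by simpc; rewrite mulrC.
Qed.

Lemma evolution_ahat n j :
  U *m ahat eps n j = expi (- (omega N eps n * eps)) *: (ahat eps n j *m U).
Proof. by rewrite UE; apply: (mxexp_annihilate ahat_anticomm ahat_adj_anticomm _ (n, j)). Qed.

Lemma evolution_adj_ahat n j :
  U *m adj (ahat eps n j) = expi (omega N eps n * eps) *: (adj (ahat eps n j) *m U).
Proof. by rewrite UE; apply: (mxexp_create ahat_anticomm ahat_adj_anticomm _ (n, j)). Qed.

Lemma evolution_vacuum : U *m vacuum R (Hmodes N L) = vacuum R (Hmodes N L).
Proof.
rewrite UE; apply: (mxexp_vacuum ahat_anticomm ahat_adj_anticomm) => i.
rewrite ahatE mulmx_suml; apply: big1 => t _.
by rewrite -scalemxAl ladder_vacuum scaler0.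
Qed.

Lemma evolution_parity : U *m parity R (Hmodes N L) = parity R (Hmodes N L) *m U.
Proof.
rewrite UE; apply: (mxexp_even ahat_anticomm ahat_adj_anticomm) => i.
  rewrite ahatE mulmx_sumr mulmx_suml -sumrN; apply: eq_bigr => t _.
  by rewrite -scalemxAl -scalemxAr parity_ladder scalerN.
rewrite adj_ahatE mulmx_sumr mulmx_suml -sumrN; apply: eq_bigr => t _.
by rewrite -scalemxAl -scalemxAr parity_adj_ladder scalerN.
Qed.

Lemma ladder_ahat (t : 'I_N) (j : 'I_L) :
  ladder R (t, j) = \sum_(n < N) conjc (dft n t) *: ahat eps n j.
Proof.
rewrite -[LHS](sum_kronecker (fun s => ladder R (s, j))).
under [RHS]eq_bigr do rewrite ahatE scaler_sumr.
rewrite exchange_big; apply: eq_bigr => s _.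
rewrite -dft_orthonormal_col scaler_suml; apply: eq_bigr => n _.
by rewrite scalerA.
Qed.

Lemma adj_ladder_ahat (t : 'I_N) (j : 'I_L) :
  adj (ladder R (t, j)) = \sum_(n < N) dft n t *: adj (ahat eps n j).
Proof.
rewrite ladder_ahat adj_sum; apply: eq_bigr => n _.
by rewrite adjointZ conjcK.
Qed.

(** The phases acquired by the Fourier modes advance the inverse transform by one time step. The sum
    is left unfolded because t + 1 may equal N, which is not a slice. *)
Let evolution_sum (t : 'I_N) (j : 'I_L) :
  U *m ladder R (t, j) = (\sum_(n < N) conjc (dft n t.+1) *: ahat eps n j) *m U.
Proof.
rewrite ladder_ahat mulmx_sumr mulmx_suml; apply: eq_bigr => n _.
by rewrite -scalemxAr evolution_ahat scalerA -dft_shift scalemxAl.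
Qed.

Let evolution_adj_sum (t : 'I_N) (j : 'I_L) :
  U *m adj (ladder R (t, j)) = (\sum_(n < N) dft n t.+1 *: adj (ahat eps n j)) *m U.
Proof.
rewrite adj_ladder_ahat mulmx_sumr mulmx_suml; apply: eq_bigr => n _.
rewrite -scalemxAr evolution_adj_ahat scalerA scalemxAl; congr (_ *: _ *m _).
by rewrite -[dft n t.+1]conjcK dft_shift conjcM conjcK conjc_expi opprK.
Qed.

Lemma evolution_gop b (t s : 'I_N) (j : 'I_L) : s = t.+1 :> nat ->
  U *m gop R b (t, j) = gop R b (s, j) *m U.
Proof.
case: b => st /=.
  by rewrite evolution_adj_sum -st -adj_ladder_ahat.
by rewrite evolution_sum -st -ladder_ahat.
Qed.

(** By antiperiodicity the inverse transform at time N is minus the one at time 0. *)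
Lemma evolution_gop_last b (t s : 'I_N) (j : 'I_L) : t.+1 = N -> s = 0%N :> nat ->
  U *m gop R b (t, j) = - (gop R b (s, j) *m U).
Proof.
move=> tN s0; rewrite -mulNmx; case: b => /=.
  rewrite evolution_adj_sum tN adj_ladder_ahat s0 -sumrN.
  by under eq_bigr do rewrite dft_antiperiodic scaleNr.
rewrite evolution_sum tN ladder_ahat s0 -sumrN.
by under eq_bigr do rewrite dft_antiperiodic rmorphN scaleNr.
Qed.

End TimeTranslation.

(** * Reordering of signed-commuting factors and the sign of time ordering *)

Section SignedReordering.
Variables (A : pzRingType) (k : nat) (F : 'I_k -> A) (b : 'I_k -> bool).
Variable T : seq 'I_k.
Implicit Types (r : seq 'I_k).

(** The exponent of the time-ordering sign, relative to a sublist so that an induction can remove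
    factors one at a time. *)
Definition inversions r : nat :=
  \sum_(x <- r) \sum_(y <- r | (x < y)%N && (index y T < index x T)%N) (b x && b y).

Hypothesis T_uniq : uniq T.
Hypothesis signed_comm : forall x y : 'I_k, (x < y)%N -> (index y T < index x T)%N ->
  F x * F y = (-1) ^+ (b x && b y) * (F y * F x).

(** Insertion sort: once the tail is reordered, the head moves right past exactly those elements
    that [T] lists before it, and each of these forms an inversion with it. *)
Lemma signed_reordering r :
  sorted (fun x y : 'I_k => (x < y)%N) r -> {subset r <= T} ->
  \prod_(x <- r) F x =
  (-1) ^+ inversions r * \prod_(x <- [seq y <- T | y \in r]) F x.
Proof.
have lt_trans : transitive (fun x y : 'I_k => (x < y)%N).
  by move=> y x z; apply: ltn_trans.
rewrite (sorted_pairwise lt_trans).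
elim: r => [|x r IH] /=.
  by rewrite /inversions !big_nil (eq_filter (a2 := pred0)) // filter_pred0 big_nil mul1r.
move=> /andP[xr pr] rT.
have xNr : x \notin r by apply/negP => /(allP xr); rewrite ltnn.
have {}IH := IH pr (fun y yr => rT y (@mem_behead _ (x :: r) y yr)).
have xT : x \in T by apply: rT; rewrite mem_head.
set p := take (index x T) T; set q := drop (index x T).+1 T.
have TE : T = p ++ x :: q.
  by rewrite -{1}(cat_take_drop (index x T) T) (drop_nth x) ?index_mem // nth_index.
have pE y : y \in T -> (y \in p) = (index y T < index x T)%N.
  by move=> yT; rewrite /p in_take.
have uT := T_uniq; rewrite TE cat_uniq /= in uT.
case/and4P: uT => up; rewrite negb_or => /andP[xp _] xq _.
have fx s : x \notin s -> [seq y <- s | y \in x :: r] = [seq y <- s | y \in r].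
  move=> xs; apply: eq_in_filter => y ys; rewrite inE.
  by case: eqP => // yx; rewrite -yx ys in xs.
have E1 : [seq y <- T | y \in x :: r] =
    [seq y <- p | y \in r] ++ x :: [seq y <- q | y \in r].
  by rewrite TE filter_cat /= mem_head !fx.
have E2 : [seq y <- T | y \in r] = [seq y <- p | y \in r] ++ [seq y <- q | y \in r].
  by rewrite TE filter_cat /= (negPf xNr).
(* As [x] lies below all of [r], it can only be the first entry of an inversion. *)
have inv_cons : inversions (x :: r) =
    ((\sum_(y <- [seq y <- p | y \in r]) (b x && b y)) + inversions r)%N.
  rewrite /inversions big_cons big_cons ltnn /=; congr (_ + _)%N; last first.
    apply: eq_big_seq => y yr; rewrite big_cons ltnNge.
    by rewrite (ltnW (allP xr y yr)).
  rewrite -big_filter; apply: perm_big; apply: uniq_perm.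
  - by rewrite filter_uniq // (pairwise_uniq _ pr) // => z; rewrite ltnn.
  - by rewrite filter_uniq.
  move=> y; rewrite !mem_filter; have [yr|] := boolP (y \in r); last by rewrite andbF.
  by rewrite (allP xr y yr) pE ?andbT //; apply: rT; rewrite inE yr orbT.
have move_left s : {subset s <= p} -> {subset s <= r} ->
    F x * \prod_(y <- s) F y =
    (-1) ^+ (\sum_(y <- s) (b x && b y))%N * (\prod_(y <- s) F y * F x).
  elim: s => [|y s IHs] sp sr; first by rewrite !big_nil expr0 !mul1r mulr1.
  have yr : y \in r by apply: sr; rewrite mem_head.
  rewrite !big_cons mulrA signed_comm; first last.
  - by rewrite -pE ?sp ?mem_head //; apply: rT; rewrite inE yr orbT.
  - exact: (allP xr).
  rewrite -!mulrA IHs => [|z zs|z zs]; first last.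
  - by apply: sr; rewrite inE zs orbT.
  - by apply: sp; rewrite inE zs orbT.
  by rewrite exprD -!mulrA; congr (_ * _);
    rewrite !mulrA commr_sign.
rewrite big_cons IH E1 E2 inv_cons !big_cat big_cons /=.
rewrite addnC exprD [LHS]mulrA (commr_sign (F x)) -!mulrA; congr (_ * _).
by rewrite [LHS]mulrA move_left ?mulrA // => y; rewrite mem_filter => /andP[].
Qed.

End SignedReordering.

Lemma tsort_uniq k (s : 'I_k -> nat) : uniq (tsort s).
Proof. by rewrite sort_uniq enum_uniq. Qed.

Lemma mem_tsort k (s : 'I_k -> nat) x : x \in tsort s.
Proof. by rewrite mem_sort mem_enum. Qed.

Lemma sorted_enum_ord k : sorted (fun x y : 'I_k => (x < y)%N) (enum 'I_k).
Proof. by rewrite -(@sorted_map _ _ val ltn) val_enum_ord iota_ltn_sorted. Qed.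

Lemma tgammaE k (s : 'I_k -> nat) (b : {ffun 'I_k -> bool}) :
  tgamma s b = inversions b (tsort s) (enum 'I_k).
Proof.
rewrite /inversions /tgamma big_enum -sum1_card.
under [RHS]eq_bigr do rewrite big_enum_cond.
rewrite pair_big_dep big_mkcond [RHS]big_mkcond; apply: eq_bigr => -[x y] _ /=.
rewrite inE /=.
by case: (x < y)%N; case: (b x); case: (b y); case: (_ < _)%N.
Qed.

(** Stability of the sort keeps factors with equal labels in order. Hence factors are exchanged only
    across distinct slices, where they commute up to sign. *)
Lemma tsort_inversion k (s : 'I_k -> nat) (x y : 'I_k) :
  (x < y)%N -> (index y (tsort s) < index x (tsort s))%N -> s x != s y.
Proof.
move=> xy yx; apply/negP => /eqP sxy.
have tot : total (fun l m : 'I_k => s m <= s l)%N by move=> l m; apply: leq_total.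
have tr : transitive (fun l m : 'I_k => s m <= s l)%N.
  by move=> m l u lm mu; apply: leq_trans mu lm.
have st := sort_stable tot _ (sorted_enum_ord k).
have {}st := st (fun _ _ _ => @ltn_trans _ _ _).
(* The stable list is sorted for the label order with ties broken by position; equal labels would
   then force y < x. What remains is transitivity of this relation. *)
have := sorted_ltn_index _ st y x (mem_tsort s y) (mem_tsort s x) yx.
rewrite /= sxy leqnn /= ltnNge (ltnW xy) => H; apply: notF; apply: H.
move=> m l u /= /andP[ml /implyP mlt] /andP[lu /implyP lut].
rewrite (tr _ _ _ ml lu) /=; apply/implyP => ul.
by apply: ltn_trans (mlt _) (lut _); [apply: tr ul | apply: tr ul _].
Qed.

Lemma big_enumT (A : Type) (idx : A) (op : A -> A -> A) (I : finType) (F : I -> A) :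
  \big[op/idx]_(i <- enum I) F i = \big[op/idx]_i F i.
Proof. by rewrite enumT; apply: congr_big => //; rewrite [index_enum]unlock. Qed.

Lemma mxtrace_sum (A : pzRingType) n (I : Type) (r : seq I) (F : I -> 'M[A]_n) :
  \tr (\sum_(i <- r) F i) = \sum_(i <- r) \tr (F i).
Proof. exact: raddf_sum. Qed.

(** * Operators on slices, graded commutation, and gluing under the trace *)

Section SliceAlgebra.
Variables (R : realType) (M : finType) (n N : nat).
Variables (P : 'M[R[i]]_n) (g : bool -> 'I_N -> M -> 'M[R[i]]_n).
Variable iota : 'I_N -> op R M -> 'M[R[i]]_n.
Hypothesis P_sqr : P *m P = 1%:M.
Hypothesis P_gen : forall b t i, P *m g b t i = - (g b t i *m P).
Hypothesis gen_anticomm : forall b b' (t s : 'I_N) i j, t != s ->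
  g b t i *m g b' s j = - (g b' s j *m g b t i).
Hypothesis iotaD : forall t (X Y : op R M), iota t (X + Y) = iota t X + iota t Y.
Hypothesis iotaZ : forall t a (X : op R M), iota t (a *: X) = a *: iota t X.
Hypothesis iotaM : forall t (X Y : op R M), iota t (X *m Y) = iota t X *m iota t Y.
Hypothesis iota1 : forall t, iota t 1%:M = 1%:M.
Hypothesis iota_gop : forall t b i, iota t (gop R b i) = g b t i.

(** Supercommutation with slice [t], phrased for [B] of mixed parity: conjugation by [P] flips the
    sign of the odd part only. *)
Definition graded_commute (t : 'I_N) (B : 'M[R[i]]_n) : Prop :=
  forall b i, B *m g b t i = g b t i *m (P *m B *m P).

Lemma P_conj_gen b t i : P *m g b t i *m P = - g b t i.
Proof. by rewrite P_gen mulNmx -mulmxA P_sqr mulmx1. Qed.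

Lemma graded_commute1 t : graded_commute t 1%:M.
Proof. by move=> b i; rewrite mulmx1 P_sqr mul1mx mulmx1. Qed.

Lemma graded_commuteD t A B :
  graded_commute t A -> graded_commute t B -> graded_commute t (A + B).
Proof.
by move=> tA tB b i; rewrite mulmxDl tA tB !(mulmxDr, mulmxDl).
Qed.

Lemma graded_commuteZ t a A : graded_commute t A -> graded_commute t (a *: A).
Proof.
move=> tA b i; rewrite -scalemxAl tA.
by rewrite -[P *m (_ *: _)]scalemxAr -[(_ *: _) *m P]scalemxAl -scalemxAr.
Qed.

Lemma graded_commuteM t A B :
  graded_commute t A -> graded_commute t B -> graded_commute t (A *m B).
Proof.
move=> tA tB b i; rewrite -mulmxA tB mulmxA tA -!mulmxA; congr (_ *m (_ *m (_ *m _))).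
by rewrite [P *m (P *m _)]mulmxA P_sqr mul1mx.
Qed.

Lemma graded_commute_gen t s b i : t != s -> graded_commute t (g b s i).
Proof.
by move=> ts b' j; rewrite P_conj_gen mulmxN gen_anticomm // eq_sym.
Qed.

Lemma graded_commute_slice t s X : t != s -> graded_commute t (iota s X).
Proof.
move=> ts; elim: (generatedT X) => [|A B _ IA _ IB|a A _ IA|b i A _ IA].
- by rewrite iota1; exact: graded_commute1.
- by rewrite iotaD; exact: graded_commuteD.
- by rewrite iotaZ; exact: graded_commuteZ.
- by rewrite iotaM iota_gop; apply: graded_commuteM => //; apply: graded_commute_gen.
Qed.

(** Both conjugations flip the sign of each generator, so they agree by induction on generation. *)
Lemma iota_parity t X :
  iota t (parity R M *m X *m parity R M) = P *m iota t X *m P.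
Proof.
elim: (generatedT X) => [|A B _ IA _ IB|a A _ IA|b i A _ IA].
- by rewrite mulmx1 parity_sqr iota1 mulmx1 P_sqr.
- by rewrite iotaD !(mulmxDl, mulmxDr) iotaD IA IB.
- by rewrite iotaZ -!scalemxAr -!scalemxAl iotaZ IA.
- have -> : parity R M *m (gop R b i *m A) *m parity R M =
      - (gop R b i *m (parity R M *m A *m parity R M)).
    by rewrite !mulmxA parity_gop !mulNmx.
  rewrite -scaleN1r iotaZ !(iotaM _ (gop R b i)) iota_gop IA scaleN1r !mulmxA.
  by rewrite P_gen !mulNmx.
Qed.

Definition homogeneous (b : bool) (X : op R M) : Prop :=
  parity R M *m X *m parity R M = (-1) ^+ b *: X.

Lemma homogeneous_par_part b X : homogeneous b (@par_part R M b X).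
Proof.
rewrite /homogeneous /par_part invmx_parity -scalemxAr -scalemxAl scalerA mulrC -scalerA.
congr (_ *: _); set Q := parity R M.
have QQ : Q *m (Q *m X *m Q) *m Q = X.
  by rewrite !mulmxA parity_sqr mul1mx -mulmxA parity_sqr mulmx1.
case: b; rewrite ?mulmxBr ?mulmxDr ?mulmxBl ?mulmxDl QQ.
  by rewrite expr1 scaleN1r opprB.
by rewrite expr0 scale1r addrC.
Qed.

Lemma sum_par_part X : \sum_b @par_part R M b X = X.
Proof.
rewrite big_bool /par_part /= -scalerDr addrACA addNr addr0 -mulr2n -[X *+ 2]scaler_nat.
by rewrite scalerA mulVf ?scale1r // pnatr_eq0.
Qed.

Lemma homogeneous_commute (b b' : bool) (t s : 'I_N) X Y :
  homogeneous b X -> homogeneous b' Y -> t != s ->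
  iota t X *m iota s Y = (-1) ^+ (b && b') *: (iota s Y *m iota t X).
Proof.
move=> hX hY ts.
have hB : P *m iota s Y *m P = (-1) ^+ b' *: iota s Y.
  by rewrite -iota_parity hY iotaZ.
have tB := graded_commute_slice Y ts.
set B := iota s Y in hB tB *.
have gB b0 i : g b0 t i *m B = (-1) ^+ b' *: (B *m g b0 t i).
  by rewrite tB hB -scalemxAr scalerA -expr2 sqrr_sign scale1r.
case: b' hB gB {hY} => hB gB; last first.
  rewrite andbF scale1r; elim: (generatedT X) => [|A C _ IA _ IC|a A _ IA|b0 i A _ IA].
  - by rewrite iota1 mul1mx mulmx1.
  - by rewrite iotaD mulmxDl mulmxDr IA IC.
  - by rewrite iotaZ -scalemxAl -scalemxAr IA.
  - by rewrite iotaM iota_gop -mulmxA IA !mulmxA gB scale1r.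
(* For odd [Y] each generator in [X] contributes a sign. Replacing the sign of [X] by conjugation
   with [P] yields a claim linear in [X], open to induction. *)
rewrite andbT scalemxAr -iotaZ -hX iota_parity.
elim: (generatedT X) => [|A C _ IA _ IC|a A _ IA|b0 i A _ IA].
- by rewrite iota1 mul1mx mulmx1 P_sqr mulmx1.
- by rewrite iotaD !(mulmxDl, mulmxDr) IA IC.
- by rewrite iotaZ -!(scalemxAl, scalemxAr) IA.
- rewrite iotaM iota_gop -[LHS]mulmxA IA [LHS]mulmxA gB expr1 scaleN1r.
  by rewrite [P *m (_ *m _)]mulmxA P_gen !(mulNmx, mulmxN) !mulmxA.
Qed.

Variable U : 'M[R[i]]_n.
Hypothesis U_parity : U *m P = P *m U.
Hypothesis U_gen : forall b (t s : 'I_N) i, s = t.+1 :> nat ->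
  U *m g b t i = g b s i *m U.
Hypothesis U_gen_last : forall b (t s : 'I_N) i, t.+1 = N -> s = 0%N :> nat ->
  U *m g b t i = - (g b s i *m U).

Let Phi X : R[i] := \tr (P *m U *m X).

Let PhiD X Y : Phi (X + Y) = Phi X + Phi Y.
Proof. by rewrite /Phi mulmxDr raddfD. Qed.

Let PhiZ a X : Phi (a *: X) = a * Phi X.
Proof. by rewrite /Phi -scalemxAr mxtraceZ. Qed.

(* A generator on slice t is carried to slice t+1 by going once around the trace:
   it passes A, P and U, reappears on the right and passes B. *)
Lemma glue_gen A B (t s : 'I_N) b i : s = t.+1 :> nat ->
  graded_commute t A -> graded_commute s B ->
  Phi (A *m g b t i *m B) = Phi (A *m g b s i *m B).
Proof.
move=> st tA sB.
transitivity (- \tr (P *m U *m (P *m A *m P) *m B *m g b s i)).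
  rewrite /Phi tA -!mulmxA [U *m (g _ _ _ *m _)]mulmxA (U_gen _ _ st) -!mulmxA.
  rewrite [P *m (g _ _ _ *m _)]mulmxA P_gen !mulNmx raddfN /=; congr (- _).
  by rewrite -mulmxA mxtrace_mulC -!mulmxA.
rewrite -mulmxA sB /Phi.
have -> : A *m g b s i *m B = P *m (P *m A *m P *m (P *m g b s i *m P)
    *m (P *m B *m P)) *m P.
  rewrite !mulmxA P_sqr mul1mx -!mulmxA P_sqr mulmx1.
  by rewrite ![P *m (P *m _)]mulmxA P_sqr !mul1mx.
rewrite P_conj_gen !(mulmxN, mulNmx) raddfN /=; congr (- _).
by rewrite [in RHS]mulmxA [in RHS]mxtrace_mulC !mulmxA P_sqr mul1mx U_parity.
Qed.

(** The leading generator of [Y] moves to slice [s] and then joins [A], which still graded-commutes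
    with slice [t]; hence [A] is generalised in the induction. *)
Lemma glue_next A Y (t s : 'I_N) : s = t.+1 :> nat -> graded_commute t A ->
  Phi (A *m iota t Y) = Phi (A *m iota s Y).
Proof.
move=> st; have ts : s != t by rewrite -val_eqE /= st gtn_eqF.
elim: (generatedT Y) A => [|X Z _ IX _ IZ|a X _ IX|b i X _ IX] A tA.
- by rewrite !iota1.
- by rewrite !iotaD !mulmxDr !PhiD IX // IZ.
- by rewrite !iotaZ -!scalemxAr !PhiZ IX.
- rewrite !iotaM !iota_gop !mulmxA (glue_gen _ _ st) //.
    apply: IX; apply: graded_commuteM => //; apply: graded_commute_gen.
    by rewrite eq_sym.
  exact: graded_commute_slice.
Qed.

Lemma glue A Y (t s : 'I_N) : (t <= s)%N ->
  (forall r : 'I_N, (r < s)%N -> graded_commute r A) ->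
  Phi (A *m iota t Y) = Phi (A *m iota s Y).
Proof.
move=> ts tA; have [k sE] : exists k, s = (t + k)%N :> nat.
  by exists (s - t)%N; rewrite subnKC.
elim: k s sE {ts} tA => [|k IH] s sE tA.
  by congr (Phi (A *m iota _ Y)); apply: val_inj; rewrite /= sE addn0.
have lt : (t + k < N)%N by rewrite (leq_trans _ (ltnW (ltn_ord s))) // sE addnS.
rewrite (IH (Ordinal lt)) //= => [|r rs].
  by apply: glue_next; [rewrite sE addnS | apply: tA; rewrite sE addnS].
by apply: tA; rewrite sE addnS ltnW.
Qed.

(** * The functional on a single slice and its identification with the trace *)

Variables (s0 : 'I_N) (V : 'M[R[i]]_n).
Hypothesis s0E : s0 = 0%N :> nat.

Let f X := Phi (iota s0 X).

Lemma ordered_trace (I : Type) (r : seq I) (t : I -> 'I_N) (X : I -> op R M) :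
  pairwise (fun x y => (t y <= t x)%N) r ->
  Phi (\prod_(x <- r) iota (t x) (X x)) = f (\prod_(x <- r) X x).
Proof.
(* [Y] accumulates the factors already absorbed from the right. It sits on a slice [s] below all
   remaining labels and is lifted to the label of the last factor to merge with it. *)
suff H (s : 'I_N) Y : pairwise (fun x y => (t y <= t x)%N) r ->
    all (fun x => (s <= t x)%N) r ->
    Phi ((\prod_(x <- r) iota (t x) (X x)) *m iota s Y) =
    f ((\prod_(x <- r) X x) *m Y).
  move=> tr; have := H s0 1%:M tr; rewrite iota1 !mulmx1; apply.
  by rewrite (@eq_all _ _ predT) ?all_predT // => x; rewrite /= s0E.
elim/last_ind: r s Y => [|r x IH] s Y.
  move=> _ _; rewrite !big_nil /f !mul1mx.
  have := @glue 1%:M Y s0 s; rewrite s0E !mul1mx => -> // r _.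
  exact: graded_commute1.
rewrite pairwise_rcons all_rcons => /andP[xr pr] /andP[sx sr].
rewrite -!cats1 !big_cat !big_seq1 /= -!mulmxE.
rewrite (glue _ sx) => [|u ux].
  rewrite -!mulmxA -iotaM; exact: IH.
apply: graded_commuteM; last first.
  by apply: graded_commute_slice; rewrite -val_eqE /= ltn_eqF.
elim: r xr {IH pr sr} => [|y r IHr] /=.
  by rewrite big_nil => _; exact: graded_commute1.
move=> /andP[xy xr]; rewrite big_cons; apply: graded_commuteM; last exact: IHr.
by apply: graded_commute_slice; rewrite -val_eqE /= ltn_eqF // (leq_trans ux).
Qed.

(** The generator is lifted from slice 0 to slice N - 1, then once more around the trace to slice 0,
    now on the right of [Y]. The sign of antiperiodicity cancels the one from crossing [P]. *)
Lemma slice_trace_gop b i Y : f (gop R b i *m Y) = f (Y *m gop R b i).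
Proof.
have last_lt : (N.-1 < N)%N by rewrite prednK // (leq_trans _ (ltn_ord s0)).
have H k (t : 'I_N) : t = k :> nat -> Phi (g b t i *m iota s0 Y) = f (gop R b i *m Y).
  elim: k t => [|k IH] t tk.
    rewrite /f iotaM iota_gop; congr (Phi (g b _ i *m _)).
    by apply: val_inj; rewrite /= tk s0E.
  have lt : (k < N)%N by rewrite ltnW // -tk.
  rewrite -(IH (Ordinal lt)) // -[g b t i]mul1mx -[g b (Ordinal lt) i]mul1mx.
  rewrite (@glue_gen 1%:M (iota s0 Y) (Ordinal lt) t) //; first exact: graded_commute1.
  by apply: graded_commute_slice; rewrite -val_eqE /= tk s0E.
rewrite -(H _ (Ordinal last_lt) erefl) /f iotaM iota_gop /Phi.
rewrite [in LHS]mulmxA -[P *m U *m g _ _ _]mulmxA (@U_gen_last _ _ s0) //=; last first.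
  by rewrite prednK // (leq_trans _ (ltn_ord s0)).
rewrite mulmxN !mulmxA P_gen !mulNmx opprK -!mulmxA mxtrace_mulC.
by rewrite !mulmxA.
Qed.

Lemma slice_trace_mulC X Y : f (X *m Y) = f (Y *m X).
Proof.
elim: (generatedT X) Y => [|A B _ IA _ IB|a A _ IA|b i A _ IA] Y.
- by rewrite mulmx1 mul1mx.
- by rewrite mulmxDl mulmxDr /f !iotaD !PhiD; congr (_ + _); [exact: IA|exact: IB].
- by rewrite -scalemxAl -scalemxAr /f !iotaZ !PhiZ; congr (_ * _); exact: IA.
- by rewrite -mulmxA slice_trace_gop -mulmxA IA mulmxA.
Qed.

(** Cyclicity kills off-diagonal matrix units and gives every diagonal one the value at |0><0|. *)
Lemma slice_traceE Y : f Y = f (vacuum R M) * \tr Y.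
Proof.
have f0 : f 0 = 0 by rewrite -(scale0r (1%:M : op R M)) /f iotaZ PhiZ mul0r.
have fD A B : f (A + B) = f A + f B by rewrite /f iotaD PhiD.
rewrite {1}(matrix_sum_delta Y) (big_morph f fD f0) /mxtrace mulr_sumr.
apply: eq_bigr => i _; rewrite (big_morph f fD f0) (bigD1 i) //= big1 ?addr0.
  rewrite /f iotaZ PhiZ mulrC; congr (_ * _); rewrite -!/(f _) /vacuum.
  set e : 'I_(fdim M) := enum_rank finset.set0.
  by rewrite -(mul_delta_mx e) slice_trace_mulC mul_delta_mx.
move=> j ji; rewrite /f iotaZ PhiZ -/(f _).
by rewrite -(mul_delta_mx i) slice_trace_mulC mul_delta_mx_0 // f0 mulr0.
Qed.

Hypothesis P_V : P *m V = V.
Hypothesis U_V : U *m V = V.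
Hypothesis tr_V : \tr V = 1.
Hypothesis V_slices : \prod_(t <- rev (enum 'I_N)) iota t (vacuum R M) = V.

(** The constant is found by writing |0><0| as its own N-th power and spreading the copies over all
    slices, in decreasing order. The result is [V], which [P] and [U] fix and whose trace is 1. *)
Lemma slice_trace Y : f Y = \tr Y.
Proof.
rewrite slice_traceE [X in X * _](_ : _ = 1) ?mul1r //.
have vE (r : seq 'I_N) : (0 < size r)%N ->
    \prod_(t <- r) vacuum R M = vacuum R M.
  elim: r => // t [|u r] IH _; first by rewrite big_seq1.
  by rewrite big_cons IH // -mulmxE /vacuum mul_delta_mx.
rewrite -(vE (rev (enum 'I_N))); last first.
  by rewrite size_rev size_enum_ord (leq_trans _ (ltn_ord s0)).
rewrite -(@ordered_trace _ _ id (fun=> vacuum R M)).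
  by rewrite V_slices /Phi -mulmxA U_V P_V.
rewrite -sorted_pairwise => [|x y z xy yz]; last exact: leq_trans yz xy.
rewrite rev_sorted -(@sorted_map _ _ val leq) val_enum_ord.
exact: iota_sorted.
Qed.

Lemma time_ordered_trace (k : nat) (O : 'I_k -> op R M) (t : 'I_k -> 'I_N) :
  \tr (P *m U *m \prod_(l < k) iota (t l) (O l)) =
  \tr (Tord O (fun l => nat_of_ord (t l))).
Proof.
have iota0 s : iota s 0 = 0 by rewrite -(scale0r 0) iotaZ scale0r.
pose F (c : {ffun 'I_k -> bool}) l := @par_part R M (c l) (O l).
have -> : \prod_(l < k) iota (t l) (O l) =
    \sum_(c : {ffun 'I_k -> bool}) \prod_(l < k) iota (t l) (F c l).
  rewrite -(bigA_distr_bigA (fun l b => iota (t l) (@par_part R M b (O l)))).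
  apply: eq_bigr => l _; rewrite -[in LHS](sum_par_part (O l)).
  by rewrite (big_morph (iota (t l)) (iotaD _) (iota0 _)).
rewrite mulmx_sumr /Tord !mxtrace_sum; apply: eq_bigr => c _.
rewrite mxtraceZ -/(F c).
have hF l : homogeneous (c l) (F c l) by exact: homogeneous_par_part.
pose s := fun l => nat_of_ord (t l).
(* Inversions involve distinct slices, so parts of definite parity can be exchanged there; this
   yields exactly the sign in [Tord]. *)
have -> : \prod_(l < k) iota (t l) (F c l) =
    (-1) ^+ tgamma s c *: \prod_(l <- tsort s) iota (t l) (F c l).
  rewrite -[LHS]big_enumT (signed_reordering (b := c) (tsort_uniq s)); first last.
  - by move=> x _; exact: mem_tsort.
  - exact: sorted_enum_ord.
  - move=> x y xy yx; have := tsort_inversion xy yx; rewrite /s val_eqE => ts.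
    have := homogeneous_commute (hF x) (hF y) ts; rewrite !mulmxE => ->.
    by case: (_ && _); rewrite ?expr1 ?expr0 ?mulN1r ?scaleN1r ?mul1r ?scale1r.
  - rewrite -tgammaE (eq_filter (a2 := predT)) => [|l]; last by rewrite mem_enum.
    rewrite filter_predT -signr_odd -[in RHS]signr_odd.
    by case: odd; rewrite ?expr1 ?expr0 ?mulN1r ?scaleN1r ?mul1r ?scale1r.
rewrite -scalemxAr mxtraceZ; congr (_ * _).
rewrite -slice_trace; apply: ordered_trace.
rewrite -sorted_pairwise => [|x y z xy yz]; last exact: leq_trans yz xy.
by apply: sort_sorted => x y; apply: leq_total.
Qed.

End SliceAlgebra.

(** * Instantiation on the Fock space over all slices *)

Lemma vacuum_slices (R : realType) (L N : nat)
  (iota : 'I_N -> op R (hmodes L) -> op R (Hmodes N L)) :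
  slice_maps iota ->
  \prod_(t <- rev (enum 'I_N)) iota t (vacuum R (hmodes L)) =
  vacuum R (Hmodes N L).
Proof.
move=> hi; rewrite -!vacproj.
(* The image of |0><0| is diagonal in the occupation basis and tests whether slice [t] is empty; the
   product over [t] tests whether the whole state is. *)
have E t : iota t (\prod_(m : hmodes L) (ladder R m *m adj (ladder R m))) =
    mono (@id {set Hmodes N L}) (fun S => \prod_(m : 'I_L) ((t, m) \notin S)%:R).
  have [_ [_ [iM [i1 [iA iL]]]]] := hi t.
  rewrite (big_morph (iota t) iM i1) -mono_prod; apply: eq_bigr => m _.
  by rewrite iM iA iL ladder_mul_adj.
under eq_bigr do rewrite E.
under [RHS]eq_bigr do rewrite ladder_mul_adj.
rewrite !mono_prod; apply: mono_eq => // S.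
rewrite (perm_big (enum 'I_N)) ?perm_rev // big_enum pair_bigA.
by apply: eq_bigr => -[].
Qed.

Theorem theorem2 (R : realType) (L N : nat) (eps : R)
  (hL : (1 <= L)%N) (hN : (1 <= N)%N) (heps : 0 < eps)
  (iota : 'I_N -> op R (hmodes L) -> op R (Hmodes N L))
  (hiota : slice_maps iota)
  (k : nat) (O : 'I_k -> op R (hmodes L)) (t : 'I_k -> 'I_N) :
  \tr (parity R (Hmodes N L) *m mxexp (((0 +i* 1) * eps%:C) *: @Pmom R N L eps)
        *m \prod_(l < k) iota (t l) (O l))
  = \tr (Tord O (fun l => nat_of_ord (t l))).

Proof.
pose P := parity R (Hmodes N L).
pose g b (t : 'I_N) (i : 'I_L) : op R (Hmodes N L) := gop R b (t, i).
have P2 : P *m P = 1%:M by exact: parity_sqr.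
have Pg b s i : P *m g b s i = - (g b s i *m P) by exact: parity_gop.
have gC b b' (u s : 'I_N) i j : u != s -> g b u i *m g b' s j = - (g b' s j *m g b u i).
  move=> us; apply/eqP; rewrite -addr_eq0 /g gop_anticomm xpair_eqE (negPf us).
  by rewrite mulr0n raddf0.
have iD s (X Y : op R (hmodes L)) : iota s (X + Y) = iota s X + iota s Y.
  by have [-> _] := hiota s.
have iZ s a (X : op R (hmodes L)) : iota s (a *: X) = a *: iota s X.
  by have [_ [-> _]] := hiota s.
have iM s (X Y : op R (hmodes L)) : iota s (X *m Y) = iota s X *m iota s Y.
  by have [_ [_ [-> _]]] := hiota s.
have i1 s : iota s 1%:M = 1%:M by have [_ [_ [_ [-> _]]]] := hiota s.
have ig s b i : iota s (gop R b i) = g b s i.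
  have [_ [_ [_ [_ [iA iL]]]]] := hiota s.
  by case: b; rewrite /g /gop ?iA iL.
(* The base slice 0 exists because N >= 1, and [V] becomes |Omega><Omega|. *)
apply: (time_ordered_trace P2 Pg gC iD iZ iM i1 ig _ _ _ (s0 := Ordinal hN) erefl
  (parity_vacuum R (Hmodes N L)) _ (trace_vacuum R (Hmodes N L)) (vacuum_slices hiota)).
- exact: evolution_parity.
- by move=> b s u i; apply: evolution_gop.
- by move=> b s u i; apply: evolution_gop_last.
- exact: evolution_vacuum.
Qed.
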